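(* Let $(g_i)_{i=1}^\infty$ be a frame for $\mathcal{H}$ and let $U:\mathcal{H}\to\ell^2$, $Uf=(\langle f,g_i\rangle)_{i=1}^\infty$, be its analysis operator. Then all the s-pseudo-duals of $(g_i)_{i=1}^\infty$ are precisely the sequences $(L\delta_i)_{i=1}^\infty$, where the linear operator $L:\mathcal{D}(L)\to\mathcal{H}$ is such that $\mathcal{D}(L)$ is a linear subset of $\ell^2$ containing $\mathrm{span}\{\delta_i\}$ and $\mathcal{R}(U)$, $$L\Big(\sum_{i=1}^n\langle f,g_i\rangle\delta_i\Big)\to L\Big(\sum_{i=1}^\infty\langle f,g_i\rangle\delta_i\Big)\quad\text{as } n\to\infty,\ \text{for every } f\in\mathcal{H},$$ and $L$ is a left inverse of $U$.
   Context: $\mathcal{H}$ is an infinite-dimensional separable Hilbert space; $(\delta_i)_{i=1}^\infty$ is the canonical basis of $\ell^2$; $\mathrm{span}$ denotes the set of all finite linear combinations; $\mathcal{D}(V)$, $\mathcal{R}(V)$ denote the domain and range of an operator $V$. A sequence $(g_i)_{i=1}^\infty$ in $\mathcal{H}$ is a frame for $\mathcal{H}$ if there are $A,B>0$ with $A\|h\|^2\le\sum_{i=1}^\infty|\langle h,g_i\rangle|^2\le B\|h\|^2$ for all $h\in\mathcal{H}$. A sequence $(f_i)_{i=1}^\infty$ in $\mathcal{H}$ is an s-pseudo-dual (synthesis-pseudo-dual) of $(g_i)$ if $f=\sum_{i=1}^\infty\langle f,g_i\rangle f_i$ (norm convergence) for all $f\in\mathcal{H}$. *)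

(* Defs.v *)
From HB Require Import structures.
From mathcomp Require Import all_boot all_order all_algebra sesquilinear.
From mathcomp Require Import all_classical all_reals all_analysis.
From mathcomp Require Import complex.

Set Implicit Arguments.
Unset Strict Implicit.
Unset Printing Implicit Defensive.

Import Order.TTheory GRing.Theory Num.Theory.
Import numFieldNormedType.Exports.

Local Open Scope classical_set_scope.
Local Open Scope ring_scope.

(* Hilbert spaces may be real or complex. The field is either R, with the
   identity as conjugation, or R[i], with complex conjugation. *)
Variant scalar_kind := RealScalars | ComplexScalars.

Definition scalars (R : realType) (k : scalar_kind) : numFieldType :=
  match k with
  | RealScalars => R
  | ComplexScalars => R[i]
  end.

Definition scalars_conj (R : realType) (k : scalar_kind) :
    scalars R k -> scalars R k :=
  match k with
  | RealScalars => idfun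
  | ComplexScalars => @conjc R
  end.

Section LinearAlgebra.
Context {K : numFieldType} {V W : lmodType K}.

Definition linear_span (S : set V) : set V :=
  [set v | exists (n : nat) (a : 'I_n -> K) (x : 'I_n -> V),
     (forall i, S (x i)) /\ v = \sum_(i < n) a i *: x i].

Definition infinite_dimensional : Prop :=
  forall s : seq V, linear_span [set` s] <> setT.

(* A linear operator with domain D is represented by a total function, whose
   values outside D are irrelevant. *)
Definition linear_operator (D : set V) (L : V -> W) : Prop :=
  submod_closed (mem D) /\
  {in D &, forall x y, forall a : K, L (a *: x + y) = a *: L x + L y}.

End LinearAlgebra.
Arguments infinite_dimensional {K} V.

Definition separable (T : topologicalType) : Prop :=
  exists2 S : set T, countable S & dense S.

Section SquareSummable.
Context {K : numFieldType}.

Definition ell2 : set (nat -> K^o) :=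
  [set c | cvgn (series (fun i => `|c i| ^+ 2 : K^o))].

Definition ell2_sqnorm (c : nat -> K^o) : K^o :=
  limn (series (fun i => `|c i| ^+ 2 : K^o)).

(* Convergence in ell2, stated for the square of the norm because K need not
   have square roots. Membership in ell2 is required since ell2_sqnorm is not
   meaningful outside ell2. *)
Definition ell2_cvg (u : nat -> (nat -> K^o)) (c : nat -> K^o) : Prop :=
  [/\ forall n, ell2 (u n), ell2 c &
      ell2_sqnorm (u n - c) @[n --> \oo] --> (0 : K^o)].

Definition ell2_lim (u : nat -> (nat -> K^o)) : nat -> K^o :=
  get [set c | ell2_cvg u c].

Definition delta (i : nat) : nat -> K^o := fun j => (j == i)%:R.

End SquareSummable.

Section Frames.
Context {K : numFieldType} {theta : K -> K} {H : normedModType K}.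
Variable ip : {dot H for theta}.

Definition frame (g : nat -> H) : Prop :=
  exists A B : K, [/\ 0 < A, 0 < B &
    forall h : H,
      let s := series (fun i => `|ip h (g i)| ^+ 2 : K^o) in
      [/\ cvgn s, A * `|h| ^+ 2 <= limn s & limn s <= B * `|h| ^+ 2]].

Definition analysis (g : nat -> H) (f : H) : nat -> K^o := fun i => ip f (g i).

Definition s_pseudo_dual (g f_ : nat -> H) : Prop :=
  forall f : H, series (fun i => ip f (g i) *: f_ i) @ \oo --> f.

End Frames.

(* Main.v *)
Require Import Defs.
From mathcomp Require Import all_boot all_order all_algebra sesquilinear.
From mathcomp Require Import all_classical all_reals all_analysis.

Set Implicit Arguments.
Unset Strict Implicit.
Unset Printing Implicit Defensive.

Import Order.TTheory GRing.Theory Num.Theory.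
Import numFieldNormedType.Exports.

Local Open Scope classical_set_scope.
Local Open Scope ring_scope.

(** Write [U] for the analysis operator.  An operator [L] as in the theorem and
    a sequence [f_] with [f_ i = L (delta i)] are tied together by linearity:
    the value of [L] at a finite section of [U f] is a partial sum of the
    series of the [ip f (g i) *: f_ i].  Everything else comes from the fact
    that the sections of [U f] converge to [U f] in l^2
    ([ell2_lim_partial_sum]).

    From the operator to the s-pseudo-dual: the continuity condition along the
    sections says that the partial sums converge to [L (U f)], which is [f]
    since [L] is a left inverse of [U].

    From the s-pseudo-dual to the operator: [L] has to be the synthesis
    operator, sending [c] to the sum of the series of the [c i *: f_ i].  As
    domain take [span delta + range U], the smallest one possible, described
    as the set of sequences that agree eventually with some [U f]
    ([eventual_analysis]).  Changing finitely many terms preserves the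
    convergence of a series, so two properties of the sequences [U f] pass to
    this whole domain: membership in l^2, which is the convergence of the
    series in the definition of a frame, and convergence of the synthesis
    series, which is the definition of an s-pseudo-dual.  Well-definedness of
    [L] where [span delta] and [range U] overlap is automatic, because [L c]
    is given by one formula in [c].

    That domain is a subspace because [U] is linear, and convergence is never
    deduced from a comparison of series, so the argument runs in any normed
    space over any [numFieldType] ([s_pseudo_dual_operatorP]). *)

(** * Limits and series over a partially ordered field *)

(** A numFieldType is only partially ordered, as the complex numbers are, so
    the usual argument for total orders is not available.  Instead,
    nonnegative elements are the fixed points of the norm, which is
    continuous. *)
Lemma cvgn_ge0 (K : numFieldType) (u : nat -> K^o) (l : K^o) :
  u @ \oo --> l -> (\forall n \near \oo, 0 <= u n) -> 0 <= l.
Proof.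
move=> ul u0; suff -> : l = `|l| by exact: normr_ge0.
apply: (@cvg_unique _ (@norm_hausdorff K K^o) (u @ \oo)) => //.
have nu : `|u n| @[n --> \oo] --> (`|l| : K^o) by exact: cvg_norm.
apply: cvg_trans nu; apply: near_eq_cvg.
by apply: filterS u0 => n un0; rewrite ger0_norm.
Qed.

Lemma is_cvg_series_eventually (K : numFieldType) (V : normedModType K)
    (u v : nat -> V) :
  (\forall i \near \oo, u i = v i) -> cvgn (series u) -> cvgn (series v).
Proof.
move=> [N _ uv].
rewrite -(is_cvg_series_restrict N u) -(is_cvg_series_restrict N v).
suff -> : (fun n => \sum_(N <= i < n) u i) = fun n => \sum_(N <= i < n) v i by [].
apply/funext => n; rewrite big_nat [RHS]big_nat.
by apply: eq_bigr => i /andP[Ni _]; exact: uv.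
Qed.

(** * Finite sections in l^2 *)

Section SquareSummable.
Context {K : numFieldType}.
Implicit Types a c : nat -> K^o.

Lemma ell2_eventually a c :
  (\forall i \near \oo, `|a i| = `|c i|) -> ell2 a -> ell2 c.
Proof.
move=> ac; apply: is_cvg_series_eventually.
by apply: filterS ac => i /= ->.
Qed.

Lemma ell2_coord_le c i : ell2 c -> `|c i| ^+ 2 <= ell2_sqnorm c.
Proof.
move=> c2; rewrite -subr_ge0.
apply: (@cvgn_ge0 _ (fun n => series (fun i => `|c i| ^+ 2 : K^o) n - `|c i| ^+ 2)).
  by apply: cvgB; [exact: c2 | exact: cvg_cst].
exists i.+1 => // n /= ltin.
rewrite subr_ge0 /series/= big_mkord (bigD1 (Ordinal ltin)) //=.
by rewrite lerDl sumr_ge0 // => j _; rewrite exprn_ge0.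
Qed.

Lemma partial_sumE a n j :
  (\sum_(i < n) a i *: delta i) j = if (j < n)%N then a j else 0.
Proof.
rewrite fct_sumE; under eq_bigr => i _.
  rewrite (_ : (a i *: delta i) j = if j == i then a i else 0); first over.
  rewrite fctE /delta; case: eqP => _; first exact: mulr1.
  exact: mulr0.
case: ltnP => jn.
  rewrite (bigD1 (Ordinal jn)) //= eqxx big1 ?addr0 // => i ij.
  by rewrite ifN // eq_sym.
rewrite big1 // => i _.
by rewrite gtn_eqF // (leq_trans (ltn_ord i)).
Qed.

Lemma ell2_0 : ell2 (0 : nat -> K^o).
Proof.
rewrite /ell2 /= (_ : series _ = fun=> 0); first exact: is_cvg_cst.
by apply/funext => n; rewrite /series/= big1 // => i _; rewrite normr0 expr0n.
Qed.

Lemma partial_sum_ell2 a n : ell2 (\sum_(i < n) a i *: delta i).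
Proof.
apply: ell2_eventually ell2_0.
by exists n => // i /= ni; rewrite partial_sumE ltnNge ni.
Qed.

Lemma partial_sum_sub_ell2 a c n :
  ell2 c -> ell2 ((\sum_(i < n) a i *: delta i) - c).
Proof.
apply: ell2_eventually; exists n => // i /= ni.
by rewrite [in RHS]/GRing.add /= partial_sumE ltnNge ni /= sub0r normrN.
Qed.

(** The squared distance from [a] to its [n]-th section is the [n]-th tail of
    the convergent series defining the squared norm of [a]. *)
Lemma sqnorm_partial_sum_sub a n : ell2 a ->
  ell2_sqnorm ((\sum_(i < n) a i *: delta i) - a) =
  ell2_sqnorm a - series (fun i => `|a i| ^+ 2 : K^o) n.
Proof.
move=> a2; apply: norm_cvg_lim.
set s := series (fun i => `|a i| ^+ 2 : K^o).
have lim_tail : s m - s n @[m --> \oo] --> (ell2_sqnorm a - s n : K^o).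
  by apply: cvgB; [exact: a2 | exact: cvg_cst].
apply: cvg_trans lim_tail; apply: near_eq_cvg; exists n => // m /= nm.
rewrite /s sub_series_geq // /series /= [RHS](big_cat_nat (leq0n n) nm) /=.
rewrite [X in _ = X + _]big_nat [X in _ = X + _]big1 ?add0r => [|i /andP[_ ilt]].
  rewrite big_nat [RHS]big_nat; apply: eq_bigr => i /andP[ni _].
  by rewrite [in RHS]/GRing.add /= partial_sumE ltnNge ni sub0r normrN.
by rewrite [in LHS]/GRing.add /= partial_sumE ilt subrr normr0 expr0n.
Qed.

Lemma ell2_cvg_partial_sum a : ell2 a ->
  ell2_cvg (fun n => \sum_(i < n) a i *: delta i) a.
Proof.
move=> a2; split => // [n|]; first exact: partial_sum_ell2.
under eq_fun do rewrite sqnorm_partial_sum_sub //.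
rewrite -(subrr (ell2_sqnorm a)).
by apply: cvgB; [exact: cvg_cst | exact: a2].
Qed.

(** Convergence in l^2 forces convergence of each coordinate, and the [i]-th
    coordinate of the sections of [a] is constantly [a i] from [i.+1] on. *)
Lemma ell2_cvg_partial_sum_unique a c :
  ell2_cvg (fun n => \sum_(i < n) a i *: delta i) c -> c = a.
Proof.
move=> [_ c2 cvg0]; apply/funext => i.
(* The first 0 is a lower bound for the terms of a sequence, and the second
   one is the limit of the squared distances from [c] to the sections. *)
suff : 0 <= 0 - `|a i - c i| ^+ 2.
  rewrite sub0r oppr_ge0 => ac0; apply/eqP.
  rewrite eq_sym -subr_eq0 -normr_eq0 -sqrf_eq0.
  by rewrite eq_le ac0 exprn_ge0.
apply: (cvgn_ge0 (cvgB cvg0 (cvg_cst (`|a i - c i| ^+ 2 : K^o)))).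
exists i.+1 => // n /= ltin; rewrite subr_ge0.
have := ell2_coord_le i (@partial_sum_sub_ell2 a c n c2).
by rewrite [in X in X -> _]/GRing.add /= partial_sumE ltin.
Qed.

(** [ell2_lim] chooses some limit, so its value is known only once the limit
    is known both to exist and to be unique. *)
Lemma ell2_lim_partial_sum a : ell2 a ->
  ell2_lim (fun n => \sum_(i < n) a i *: delta i) = a.
Proof.
move=> a2; apply: ell2_cvg_partial_sum_unique.
by apply: getPex; exists a; exact: ell2_cvg_partial_sum.
Qed.

End SquareSummable.

(** * Linear operators and synthesis operators *)

Lemma linear_operator0 (K : numFieldType) (V W : lmodType K)
    (D : set V) (L : V -> W) :
  linear_operator D L -> L 0 = 0.
Proof.
move=> [[D0 _] Llin]; have := Llin _ _ D0 D0 1.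
by rewrite !scale1r addr0 => /esym/eqP; rewrite -subr_eq0 addrK => /eqP.
Qed.

Lemma linear_operator_sum (K : numFieldType) (V W : lmodType K)
    (D : set V) (L : V -> W)
    (a : nat -> K) (x : nat -> V) n :
  linear_operator D L -> (forall i, D (x i)) ->
  L (\sum_(i < n) a i *: x i) = \sum_(i < n) a i *: L (x i).
Proof.
move=> DL Dx; have L0 := linear_operator0 DL.
case: DL => -[D0 Dlin] Llin.
have Dx' i : x i \in mem D by exact/mem_set.
(* Linearity of [L] holds on [D] only, so the induction has to carry the
   membership of the partial sums along. *)
suff [] : \sum_(i < n) a i *: x i \in mem D /\
   L (\sum_(i < n) a i *: x i) = \sum_(i < n) a i *: L (x i) by [].
elim: n => [|n [IHD IHL]]; first by rewrite !big_ord0.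
rewrite !big_ord_recr /= ![_ + a n *: _]addrC.
by split; [exact: Dlin | rewrite Llin // IHL].
Qed.

Section Synthesis.
Context {K : numFieldType} {H : normedModType K}.

Definition synthesis (f_ : nat -> H) (c : nat -> K^o) : H :=
  limn (series (fun i => c i *: f_ i)).

Lemma synthesis_linear (f_ : nat -> H) (a : K) (c d : nat -> K^o) :
  cvgn (series (fun i => c i *: f_ i)) ->
  cvgn (series (fun i => d i *: f_ i)) ->
  synthesis f_ (a *: c + d) = a *: synthesis f_ c + synthesis f_ d.
Proof.
move=> cc cd; apply: norm_cvg_lim.
rewrite (_ : series _ = fun n => a *: series (fun i => c i *: f_ i) n +
                                 series (fun i => d i *: f_ i) n).
  by apply: cvgD; [apply: cvgZ; [exact: cvg_cst | exact: cc] | exact: cd].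
apply/funext => n; rewrite /series /= scaler_sumr -big_split /=.
by apply: eq_bigr => i _; rewrite !fctE scalerA -scalerDl.
Qed.

(** The partial sums of the synthesis series of a finitely supported sequence
    are eventually constant, so the limit is reached whatever [f_] is. *)
Lemma synthesis_partial_sum (f_ : nat -> H) (a : nat -> K^o) n :
  synthesis f_ (\sum_(i < n) a i *: delta i) = \sum_(i < n) a i *: f_ i.
Proof.
apply: norm_cvg_lim; apply: cvg_near_cst; exists n => // m /= nm.
rewrite /series /= (big_cat_nat (leq0n n) nm) /=.
rewrite [X in _ + X]big_nat [X in _ + X]big1 ?addr0 => [|i /andP[ni _]].
  by rewrite big_mkord; apply: eq_bigr => i _; rewrite partial_sumE ltn_ord.
by rewrite partial_sumE ltnNge ni scale0r.
Qed.

Lemma synthesis_delta (f_ : nat -> H) i : synthesis f_ (delta i) = f_ i.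
Proof.
(* [delta i] is its own section of length [i.+1]. *)
have -> : delta i = \sum_(j < i.+1) (delta i : nat -> K^o) j *: delta j.
  apply/funext => j; rewrite partial_sumE ltnS /delta.
  by case: leqP => // /gtn_eqF ->.
rewrite synthesis_partial_sum big_ord_recr /= /delta eqxx scale1r.
by rewrite big1 ?add0r // => j _; rewrite ltn_eqF ?scale0r.
Qed.

End Synthesis.

(** * Synthesis-pseudo-duals *)

Section PseudoDuals.
Context {K : numFieldType} {theta : K -> K} {H : normedModType K}.
Variables (ip : {dot H for theta}) (g : nat -> H).

(** This is [linear_span (range delta) + range (analysis ip g)]: a sequence that
    agrees with [analysis ip g f] from some index on differs from it by a
    finite combination of the [delta i].  The eventual form makes the
    invariance of convergence under finite changes directly applicable. *)
Definition eventual_analysis : set (nat -> K^o) :=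
  [set c | exists f : H, \forall i \near \oo, analysis ip g f i = c i].

Lemma eventual_analysis_lin (a : K) (c d : nat -> K^o) :
  eventual_analysis c -> eventual_analysis d -> eventual_analysis (a *: c + d).
Proof.
move=> [f fc] [h hd]; exists (a *: f + h).
apply: filterS2 fc hd => i fci hdi.
rewrite (_ : (a *: c + d) i = a *: c i + d i) // -fci -hdi.
exact: linearPl.
Qed.

Lemma eventual_analysis0 : eventual_analysis 0.
Proof. by exists 0; apply: nearW => i; rewrite /analysis linear0l. Qed.

Lemma eventual_analysis_delta i : eventual_analysis (delta i).
Proof.
exists 0, i.+1 => // j /= ij.
by rewrite /analysis linear0l /delta gtn_eqF.
Qed.

Lemma linear_span_delta_sub : linear_span (range delta) `<=` eventual_analysis.
Proof.
move=> _ [n [a [x [xdelta ->]]]]; elim/big_rec: _ => [|i c _ Dc].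
  exact: eventual_analysis0.
by have [j _ <-] := xdelta i; apply: eventual_analysis_lin => //;
   exact: eventual_analysis_delta.
Qed.

Lemma eventual_analysis_ell2 :
  (forall f, ell2 (analysis ip g f)) -> eventual_analysis `<=` ell2.
Proof.
move=> U2 c [f fc]; apply: ell2_eventually (U2 f).
by apply: filterS fc => i ->.
Qed.

Lemma eventual_analysis_synthesis (f_ : nat -> H) (c : nat -> K^o) :
  s_pseudo_dual ip g f_ -> eventual_analysis c ->
  cvgn (series (fun i => c i *: f_ i)).
Proof.
move=> dual [f fc]; apply: is_cvg_series_eventually (cvgP _ (dual f)).
by apply: filterS fc => i <-.
Qed.

(** Square-summability makes the sections of [U f] converge to [U f] in l^2, so
    [U f] can replace [ell2_lim] in the continuity condition.  Applied to a
    section, the linear [L] gives a partial sum of the synthesis series, and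
    that condition becomes the definition of an s-pseudo-dual. *)
Lemma s_pseudo_dual_operatorP (f_ : nat -> H) :
  let U := analysis ip g in
  (forall f, ell2 (U f)) ->
  s_pseudo_dual ip g f_ <->
  exists (D : set (nat -> K^o)) (L : (nat -> K^o) -> H),
    [/\ D `<=` ell2 /\ linear_operator D L,
        linear_span (range delta) `<=` D /\ range U `<=` D,
        forall f : H,
          L (\sum_(i < n) ip f (g i) *: delta i) @[n --> \oo] -->
          L (ell2_lim (fun n => \sum_(i < n) ip f (g i) *: delta i)),
        forall f : H, L (U f) = f &
        forall i : nat, f_ i = L (delta i)].
Proof.
move=> U U2; have limU f :
    ell2_lim (fun n => \sum_(i < n) ip f (g i) *: delta i) = U f.
  exact: (ell2_lim_partial_sum (U2 f)).
split=> [dual | [D [L [[_ DL] [deltaD _] Lcvg LU f_E]]] f].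
  have LU f : synthesis f_ (U f) = f by exact: norm_cvg_lim (dual f).
  exists eventual_analysis, (synthesis f_); split => //.
  - split; first exact: eventual_analysis_ell2.
    split; [split|].
    + exact/mem_set/eventual_analysis0.
    + move=> a c d /set_mem Dc /set_mem Dd.
      exact/mem_set/eventual_analysis_lin.
    + move=> c d /set_mem Dc /set_mem Dd a.
      by apply: synthesis_linear; exact: eventual_analysis_synthesis.
  - split; first exact: linear_span_delta_sub.
    by move=> _ [f _ <-]; exists f; exact: nearW.
  - move=> f; rewrite limU LU.
    under eq_fun do rewrite (synthesis_partial_sum _ (U f))
      -(big_mkord xpredT (fun i => U f i *: f_ i)).
    exact: dual.
  - by move=> i; rewrite synthesis_delta.
have Ddelta i : D (delta i).
  apply: deltaD; exists 1%N, (fun=> 1), (fun=> delta i).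
  by split; [exists i | rewrite big_ord1 scale1r].
have Lsum n : L (\sum_(i < n) ip f (g i) *: delta i) =
    series (fun i => ip f (g i) *: f_ i) n.
  rewrite (linear_operator_sum (U f) n DL Ddelta) /series /= big_mkord.
  by apply: eq_bigr => i _; rewrite f_E.
by have := Lcvg f; rewrite limU LU; under eq_fun do rewrite Lsum.
Qed.

End PseudoDuals.

Theorem corollary5p8 (R : realType) (k : scalar_kind)
    (H : completeNormedModType (scalars R k))
    (ip : {dot H for @scalars_conj R k})
    (ip_norm : forall h : H, ip h h = `|h| ^+ 2)
    (H_separable : separable H)
    (H_infinite : infinite_dimensional H)
    (g : nat -> H) (g_frame : frame ip g) (f_ : nat -> H) :
  let U := analysis ip g in
  s_pseudo_dual ip g f_ <->
  exists (D : set (nat -> (scalars R k)^o)) (L : (nat -> (scalars R k)^o) -> H),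
    [/\ D `<=` ell2 /\ linear_operator D L,
        linear_span (range delta) `<=` D /\ range U `<=` D,
        forall f : H,
          L (\sum_(i < n) ip f (g i) *: delta i) @[n --> \oo] -->
          L (ell2_lim (fun n => \sum_(i < n) ip f (g i) *: delta i)),
        forall f : H, L (U f) = f &
        forall i : nat, f_ i = L (delta i)].
Proof.
apply: s_pseudo_dual_operatorP => f.
by have [A [B [_ _ /(_ f)[]]]] := g_frame.
Qed.
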